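(* Let $\mathcal V=\{V;\nu_1,\dots,\nu_n\}$ be a vector arrangement over $\Bbbk$ with associated hyperplane arrangement $\mathcal H$. The graded Euler characteristic of $H_\partial^\bullet(\mathcal H)$ is $$\chi_q(H_\partial^\bullet(\mathcal H))=\bar\chi(\mathcal H,q),\qquad \bar\chi(\mathcal H,q)=\sum_{S\subseteq[n]}q^{|S|}(1-q)^{\dim H_S}.$$
   Context: Let $\Bbbk$ be a field of characteristic zero. A vector arrangement $\mathcal V=\{V;\nu_1,\dots,\nu_n\}$ is a finite-dimensional $\Bbbk$-vector space $V$ with an inner product together with a list of vectors $\nu_i\in V$ (zero allowed). The associated hyperplane arrangement is $\mathcal H=\{V;H_1,\dots,H_n\}$, $H_i=\nu_i^\perp$. For $S\subseteq[n]=\{1,\dots,n\}$ put $H_S=\bigcap_{s\in S}H_s$ ($H_\emptyset=V$). The inner product is understood to restrict non-degenerately to all subspaces onto which orthogonal projections are taken. Chain complex $\mathcal C_\partial(\mathcal H)=\bigoplus_{S\subseteq[n]}\bigwedge^\bullet H_S$ with bigrading $\deg\bigwedge^iH_S=(|S|+i,\,i)$. For $s\in S$, the map $\partial_{S,s}:\bigwedge^\bullet H_S\to\bigwedge^{\bullet+1}H_{S-s}$ is the inclusion $\bigwedge^\bullet H_S\subseteq\bigwedge^\bullet H_{S-s}$ followed by wedging on the left with the orthogonal projection of $\nu_s$ to $H_{S-s}$. The differential is $\partial=\bigoplus_{S,\,s\in S}\partial_{S,s}$, which has bidegree $(0,1)$; the second degree is the homological degree. The homology is $H_\partial^\bullet(\mathcal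 H)$. Graded Euler characteristic: $\chi_q(H_\partial^\bullet)=\sum_{a,i}(-1)^iq^a\dim H_\partial^{(a,i)}$, where $(a,i)$ is the bidegree. *)

(* Defs.v *)
From HB Require Import structures.
From mathcomp Require Import all_boot all_order all_algebra all_field.
From mathcomp Require Import ring.

Set Implicit Arguments.
Unset Strict Implicit.
Unset Printing Implicit Defensive.

Import GRing.Theory.
Local Open Scope ring_scope.

(** * Exterior algebra of [K^d]

    An element is the family of its coordinates in the basis
    [e_A = e_a1 /\ ... /\ e_ak] ([A = {a1 < ... < ak}]), with
    [e_A * e_B = ext_sgn A B *: e_(A :|: B)] if [A] and [B] are disjoint and
    [e_A * e_B = 0] otherwise. *)
Definition extalg (K : fieldType) (d : nat) := {ffun {set 'I_d} -> K^o}.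

HB.instance Definition _ (K : fieldType) (d : nat) := Vector.on (extalg K d).

Section ExtAlg.
Variables (K : fieldType) (d : nat).
Local Notation E := (extalg K d).
Implicit Types (A B C D : {set 'I_d}) (x y z : E).

Definition inversions A B : nat := (\sum_(a in A) \sum_(b in B) (b < a))%N.
Definition ext_sgn A B : K := (-1) ^+ inversions A B.

Definition ext_one : E := [ffun A : {set 'I_d} => (A == set0)%:R].
Definition ext_mul x y : E :=
  [ffun D : {set 'I_d} => \sum_(A : {set 'I_d} | A \subset D)
     ext_sgn A (D :\: A) * ((x A : K) * (y (D :\: A) : K))].

Lemma ext_sgn0l B : ext_sgn set0 B = 1.
Proof. by rewrite /ext_sgn /inversions big_set0. Qed.

Lemma ext_sgn0r A : ext_sgn A set0 = 1.
Proof. by rewrite /ext_sgn /inversions big1 // => a _; rewrite big_set0. Qed.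

Lemma ext_sgnUl A B C :
  [disjoint A & B] -> ext_sgn (A :|: B) C = ext_sgn A C * ext_sgn B C.
Proof.
move=> dAB; rewrite /ext_sgn -exprD /inversions -bigU //.
by congr (_ ^+ _); apply: eq_bigl => a; rewrite !inE.
Qed.

Lemma ext_sgnUr A B C :
  [disjoint B & C] -> ext_sgn A (B :|: C) = ext_sgn A B * ext_sgn A C.
Proof.
move=> dBC; rewrite /ext_sgn -exprD /inversions -big_split /=.
congr (_ ^+ _); apply: eq_bigr => a _; rewrite -bigU //.
by apply: eq_bigl => b; rewrite !inE.
Qed.

Lemma ext_mulA : associative ext_mul.
Proof.
move=> x y z; apply/ffunP=> D; rewrite !ffunE.
pose t A B C : K :=
  ext_sgn A B * ext_sgn A C * ext_sgn B C * ((x A : K) * (y B : K) * (z C : K)).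
transitivity (\sum_(A : {set 'I_d} | A \subset D)
   \sum_(B : {set 'I_d} | B \subset D :\: A) t A B (D :\: A :\: B)).
  apply: eq_bigr => A AD; rewrite ffunE !mulr_sumr; apply: eq_bigr => B BDA.
  have -> : ext_sgn A (D :\: A) = ext_sgn A B * ext_sgn A (D :\: A :\: B).
    rewrite -ext_sgnUr; last first.
      by rewrite -setI_eq0; apply/eqP/setP=> i; rewrite !inE; case: (i \in B).
    congr ext_sgn; apply/setP=> i; rewrite !inE.
    by have /implyP := subsetP BDA i; rewrite !inE; do 3!case: (i \in _).
  rewrite /t; ring.
transitivity (\sum_(C : {set 'I_d} | C \subset D)
   \sum_(A : {set 'I_d} | A \subset C) t A (C :\: A) (D :\: C)); last first.
  apply: eq_bigr => C CD; rewrite ffunE mulr_suml mulr_sumr.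
  apply: eq_bigr => A sAC.
  have -> : ext_sgn C (D :\: C) =
            ext_sgn A (D :\: C) * ext_sgn (C :\: A) (D :\: C).
    rewrite -ext_sgnUl; last first.
      by rewrite -setI_eq0; apply/eqP/setP=> i; rewrite !inE; case: (i \in A).
    congr ext_sgn; apply/setP=> i; rewrite !inE.
    by have /implyP := subsetP sAC i; do 2!case: (i \in _).
  rewrite /t; ring.
rewrite [RHS](exchange_big_dep (fun A => A \subset D)) /=; last first.
  by move=> C A CD sAC; apply: subset_trans sAC CD.
apply: eq_bigr => A AD.
rewrite [RHS](reindex_onto (fun B => A :|: B) (fun C => C :\: A)) /=; last first.
  move=> C /andP[_ sAC]; apply/setP=> i; rewrite !inE.
  by have /implyP := subsetP sAC i; do 2!case: (i \in _).
apply: eq_big => [B | B BDA].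
  rewrite subsetUl andbT subUset AD /= subsetD; congr (_ && _).
  apply/idP/eqP => [dBA | <-]; last first.
    rewrite -setI_eq0; apply/eqP/setP=> i; rewrite !inE.
    by do 2!case: (i \in _).
  by rewrite setDUl setDv set0U; apply/setDidPl.
have -> : (A :|: B) :\: A = B.
  apply/setP=> i; rewrite !inE; have /implyP := subsetP BDA i.
  by rewrite !inE; do 3!case: (i \in _).
by rewrite setDDl.
Qed.

Lemma ext_mul1 : left_id ext_one ext_mul.
Proof.
move=> x; apply/ffunP=> D; rewrite ffunE (bigD1 set0) ?sub0set //= big1.
  by rewrite ffunE eqxx setD0 ext_sgn0l !mul1r addr0.
by move=> A /andP[_ /negPf An0]; rewrite ffunE An0 mul0r mulr0.
Qed.

Lemma ext_mulr1 : right_id ext_one ext_mul.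
Proof.
move=> x; apply/ffunP=> D; rewrite ffunE (bigD1 D) //= big1.
  by rewrite ffunE setDv eqxx ext_sgn0r mul1r mulr1 addr0.
move=> A /andP[AD nAD]; rewrite ffunE setD_eq0.
suff /negPf-> : ~~ (D \subset A) by rewrite !mulr0.
by apply: contra nAD => DA; rewrite eqEsubset AD.
Qed.

Lemma ext_mulDl : left_distributive ext_mul +%R.
Proof.
move=> x y z; apply/ffunP=> D; rewrite !ffunE -big_split /=.
by apply: eq_bigr => A _; rewrite ffunE mulrDl mulrDr.
Qed.

Lemma ext_mulDr : right_distributive ext_mul +%R.
Proof.
move=> x y z; apply/ffunP=> D; rewrite !ffunE -big_split /=.
by apply: eq_bigr => A _; rewrite ffunE !mulrDr.
Qed.

Lemma ext_one_neq0 : ext_one != 0.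
Proof.
apply/eqP=> /ffunP/(_ set0); rewrite !ffunE eqxx => /eqP.
by rewrite oner_eq0.
Qed.

HB.instance Definition _ := GRing.Zmodule_isNzRing.Build E
  ext_mulA ext_mul1 ext_mulr1 ext_mulDl ext_mulDr ext_one_neq0.

Lemma ext_scaleAl (a : K) x y : a *: (x * y) = (a *: x) * y.
Proof.
apply/ffunP=> D; rewrite !ffunE scaler_sumr; apply: eq_bigr => A _.
rewrite ffunE /GRing.scale /=; ring.
Qed.

HB.instance Definition _ := GRing.Lmodule_isLalgebra.Build K E ext_scaleAl.

Lemma ext_scaleAr (a : K) x y : a *: (x * y) = x * (a *: y).
Proof.
apply/ffunP=> D; rewrite !ffunE scaler_sumr; apply: eq_bigr => A _.
rewrite ffunE /GRing.scale /=; ring.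
Qed.

HB.instance Definition _ := GRing.Lalgebra_isAlgebra.Build K E ext_scaleAr.
HB.instance Definition _ := Algebra_isFalgebra.Build K E.

Definition ext_basis A : E := [ffun B : {set 'I_d} => (B == A)%:R].

Lemma ext_basisM A B :
  ext_basis A * ext_basis B =
  if [disjoint A & B] then ext_sgn A B *: ext_basis (A :|: B) else 0.
Proof.
apply/ffunP=> D; rewrite ffunE.
have [sAD | nsAD] := boolP (A \subset D); last first.
  rewrite big1 => [|C sCD]; last first.
    rewrite ffunE; case: eqP sCD nsAD => [-> -> //|_ _ _].
    by rewrite mul0r mulr0.
  case: ifP => _; rewrite !ffunE //; case: eqP nsAD => [->|_ _].
    by rewrite subsetUl.
  by rewrite /GRing.scale /= mulr0.
rewrite (bigD1 A) //= big1 => [|C /andP[_ /negPf nCA]]; last first.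
  by rewrite ffunE nCA mul0r mulr0.
rewrite addr0 !ffunE eqxx mul1r.
have [eDA | neDA] := eqVneq (D :\: A) B.
  have dAB : [disjoint A & B].
    rewrite -setI_eq0 -eDA; apply/eqP/setP=> i; rewrite !inE.
    by case: (i \in A).
  have -> : D = A :|: B.
    rewrite -eDA; apply/setP=> i; rewrite !inE.
    by have /implyP := subsetP sAD i; do 2!case: (i \in _).
  have -> : (A :|: B) :\: A = B.
    by rewrite setDUl setDv set0U; apply/setDidPl; rewrite disjoint_sym.
  by rewrite dAB !ffunE eqxx.
rewrite mulr0; case: ifP => dAB; rewrite !ffunE //.
case: (D =P A :|: B) neDA => [-> | _ _]; last by rewrite /GRing.scale /= mulr0.
case/eqP; rewrite setDUl setDv set0U; apply/setDidPl.
by rewrite disjoint_sym.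
Qed.
End ExtAlg.

(** The exterior algebra of [V], in the coordinates given by [vbasis {:V}]. *)
Definition exterior (K : fieldType) (V : vectType K) := extalg K (\dim {:V}).

HB.instance Definition _ (K : fieldType) (V : vectType K) :=
  Falgebra.on (exterior V).

Section Exterior.
Variables (K : fieldType) (V : vectType K).
Implicit Types (v : V) (W : {vspace V}).

Definition ext_inj_fun v : exterior V :=
  \sum_(i < \dim {:V}) coord (vbasis {:V}) i v *: ext_basis K [set i].

Fact ext_inj_is_linear : linear ext_inj_fun.
Proof.
move=> a u v; rewrite /ext_inj_fun scaler_sumr -big_split /=.
by apply: eq_bigr => i _; rewrite linearP scalerDl scalerA.
Qed.

HB.instance Definition _ :=
  GRing.isLinear.Build K V (exterior V) *:%R ext_inj_fun ext_inj_is_linear.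

Definition ext_inj : 'Hom(V, exterior V) := linfun ext_inj_fun.

Lemma ext_inj_sqr v : ext_inj v * ext_inj v = 0.
Proof.
rewrite lfunE /= /ext_inj_fun; pose c i : K := coord (vbasis {:V}) i v.
pose t i j : exterior V :=
  (c i * c j) *: (ext_basis K [set i] * ext_basis K [set j]).
have tii i : t i i = 0.
  rewrite /t ext_basisM ifF ?scaler0 //.
  by apply/negbTE; rewrite disjoints1 inE eqxx.
have tji (i j : 'I_(\dim {:V})) : (i < j)%N -> t j i = - t i j.
  move=> lt_ij; rewrite /t !ext_basisM !disjoints1 !inE eq_sym.
  have -> /= : (i == j) = false by apply: ltn_eqF.
  rewrite /ext_sgn /inversions !big_set1 lt_ij ltnNge (ltnW lt_ij) /=.
  by rewrite expr1 expr0 scale1r scaleN1r scalerN mulrC setUC.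
transitivity (\sum_i \sum_j t i j).
  rewrite mulr_suml; apply: eq_bigr => i _; rewrite mulr_sumr.
  by apply: eq_bigr => j _; rewrite -scalerAl -scalerAr scalerA.
have split_t i : \sum_j t i j =
    \sum_(j < \dim {:V} | (i < j)%N) t i j +
    \sum_(j < \dim {:V} | (j < i)%N) t i j.
  rewrite (bigD1 i) //= tii add0r (bigID (fun j : 'I_(\dim {:V}) => i < j)%N) /=.
  by congr (_ + _); apply: eq_bigl => j; rewrite -val_eqE /=; case: ltngtP.
rewrite (eq_bigr _ (fun i _ => split_t i)) big_split /=.
rewrite [X in _ + X](exchange_big_dep predT) //= -big_split big1 //= => i _.
by rewrite -big_split big1 //= => j lt_ij; rewrite (tji i j) ?subrr.
Qed.

(** [/\^i W] inside [/\ V] *)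
Definition ext_pow W (i : nat) : {vspace exterior V} :=
  ((ext_inj @: W) ^+ i)%VS.
End Exterior.

Section Arrangement.
Variables (K : fieldType) (V : vectType K) (dot : {symmetric V}).
Variables (n : nat) (nu : 'I_n -> V).
Implicit Types (W : {vspace V}) (S T : {set 'I_n}).

Definition nondegenerate_on W : Prop := (W :&: orthov dot W = 0)%VS.

(** When [dot] is nondegenerate on [W], [V] is the direct sum of [W] and
    [orthov dot W], and this is the orthogonal projection onto [W]. *)
Definition orth_proj W : 'End(V) := daddv_pi W (orthov dot W).

Definition hyperplane (i : 'I_n) : {vspace V} := orthov dot <[nu i]>.
Definition flat S : {vspace V} := (\bigcap_(s in S) hyperplane s)%VS.

(** The chain space is the subspace of those [c : chain] such that
    [c S \in /\ (flat S)] for all [S]; see [chain_deg]. *)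
Definition chain := {ffun {set 'I_n} -> exterior V}.

Definition chain_inj_fun S (w : exterior V) : chain :=
  [ffun T : {set 'I_n} => if T == S then w else 0].
Definition chain_proj_fun S (c : chain) : exterior V := c S.

Fact chain_inj_is_linear S : linear (chain_inj_fun S).
Proof.
move=> a u v; apply/ffunP=> T; rewrite !ffunE.
by case: eqP => _ //; rewrite scaler0 addr0.
Qed.
Fact chain_proj_is_linear S : linear (chain_proj_fun S).
Proof. by move=> a u v; rewrite /chain_proj_fun !ffunE. Qed.

HB.instance Definition _ S := GRing.isLinear.Build K (exterior V) chain *:%R
  (chain_inj_fun S) (chain_inj_is_linear S).
HB.instance Definition _ S := GRing.isLinear.Build K chain (exterior V) *:%R
  (chain_proj_fun S) (chain_proj_is_linear S).

Definition chain_inj S : 'Hom(exterior V, chain) := linfun (chain_inj_fun S).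
Definition chain_proj S : 'Hom(chain, exterior V) := linfun (chain_proj_fun S).

(** Component of bidegree [(a, i)]: the sum of the [/\^i (flat S)] over the [S]
    with [#|S| + i = a]. *)
Definition chain_deg (a i : nat) : {vspace chain} :=
  (\sum_(S : {set 'I_n} | (#|S| + i == a)%N) chain_inj S @: ext_pow (flat S) i)%VS.

Definition diff_at S (s : 'I_n) : 'End(exterior V) :=
  amull (ext_inj V (orth_proj (flat (S :\ s)) (nu s))).

Definition diff : 'End(chain) :=
  \sum_(S : {set 'I_n}) \sum_(s in S)
     (chain_inj (S :\ s) \o diff_at S s \o chain_proj S)%VF.

Definition cycles (a i : nat) : {vspace chain} := (chain_deg a i :&: lker diff)%VS.
Definition boundaries (a i : nat) : {vspace chain} :=
  if i is j.+1 then (diff @: chain_deg a j)%VS else 0%VS.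

(** [cycles / boundaries], realised as a complement of the boundaries in the
    cycles. *)
Definition homology (a i : nat) : {vspace chain} :=
  (cycles a i :\: boundaries a i)%VS.

(** The chain space vanishes in bidegrees [(a, i)] with [i > \dim {:V}] or
    [a > n + \dim {:V}], so this is the sum over all bidegrees; the variable
    [q] is ['X]. *)
Definition graded_euler_char : {poly int} :=
  \sum_(a < (n + \dim {:V}).+1) \sum_(i < (\dim {:V}).+1)
    ((-1) ^+ i * (\dim (homology a i))%:Z) *: 'X^a.

Definition chi_bar : {poly int} :=
  \sum_(S : {set 'I_n}) 'X^#|S| * (1 - 'X) ^+ \dim (flat S).
End Arrangement.

(* Main.v *)
Require Import Defs.
From HB Require Import structures.
From mathcomp Require Import all_boot all_order all_algebra all_field.
From mathcomp Require Import ring.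

Set Implicit Arguments.
Unset Strict Implicit.
Unset Printing Implicit Defensive.

Import GRing.Theory.
Local Open Scope ring_scope.

(** The Euler characteristic of a bounded complex of finite-dimensional spaces
    is the alternating sum of the dimensions of its terms. In bidegree [(a, i)]
    the chain space is the direct sum of the [/\^i (flat S)] with
    [#|S| + i = a], so each [S] contributes
    [\sum_i (-1)^i 'C(\dim (flat S), i) q^(#|S| + i)
       = q^#|S| (1 - q)^(\dim (flat S))],
    which is its term in [chi_bar].

    This rests on two facts.

    - [dim_ext_pow]: the subspace [ext_pow W i] has dimension
      ['C(\dim W, i)]. It is spanned by the [i]-fold products of distinct
      vectors of a basis of [W] ([ext_pow_span]). These are independent because
      a basis of [W] extends to a basis of [V], for which the products over all
      sublists span an algebra of dimension equal to their number.

    - [diff_diff]: the differential squares to zero. Passing from [flat T] to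
      [flat (t |: T)], its intersection with the hyperplane of [nu t], changes
      the projection of [nu s] only by a multiple of the projection of [nu t] to
      [flat T] ([orth_proj_cap]).
      Wedging with the latter kills the change, so removing [s] then [t], or [t]
      then [s], wedges with the same two projections to [flat T] in opposite
      orders.

    The differential also preserves [a] and raises [i] by one ([limg_diff]), so
    rank-nullity gives the dimensions of the homology ([dim_homology]) and the
    ranks telescope in the alternating sum ([euler_poincare]). *)

(** * Dimension of the exterior powers *)

Fixpoint sublists (T : Type) (l : seq T) : seq (seq T) :=
  if l is b :: l' then sublists l' ++ [seq b :: m | m <- sublists l']
  else [:: [::]].

Lemma count_size_sublists (T : Type) (l : seq T) i :
  count (fun m => size m == i) (sublists l) = 'C(size l, i).
Proof.
elim: l i => [|b l IHl] [|i] //=; rewrite count_cat count_map IHl.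
  by rewrite !bin0 add1n; congr S; apply: count_pred0.
by rewrite binS -(IHl i); congr (_ + _)%N; apply: eq_count => m /=; rewrite eqSS.
Qed.

Lemma size_sublists (T : Type) (l : seq T) : size (sublists l) = (2 ^ size l)%N.
Proof.
by elim: l => //= b l IHl; rewrite size_cat size_map IHl addnn -mul2n expnS.
Qed.

Lemma mem_span_map (K : fieldType) (aT rT : vectType K) (f : 'Hom(aT, rT))
    (X : seq aT) (U : {vspace rT}) :
  {in X, forall x, f x \in U} -> {in <<X>>%VS, forall x, f x \in U}.
Proof.
move=> fX x Xx; have : f x \in (f @: <<X>>)%VS by apply: memv_img.
rewrite limg_span; apply: subvP; apply/span_subvP => y /mapP[z zX ->].
exact: fX.
Qed.

Section ExteriorDim.
Variables (K : fieldType) (V : vectType K).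
Implicit Types (u v : V) (l m : seq V) (W : {vspace V}) (x y : exterior V).
Local Notation iota := (ext_inj V).

(** Polarization of [ext_inj_sqr]. *)
Lemma ext_inj_anticomm u v : iota u * iota v = - (iota v * iota u).
Proof.
have := ext_inj_sqr (u + v); rewrite linearD mulrDl !mulrDr !ext_inj_sqr.
by rewrite addr0 add0r => /eqP; rewrite addr_eq0 => /eqP.
Qed.

Definition wedge m : exterior V := \prod_(v <- m) iota v.

(** When [l] is a basis of [W], the standard basis of [/\^i W]. *)
Definition monomials l i : seq (exterior V) :=
  [seq wedge m | m <- sublists l & size m == i].

Lemma size_monomials l i : size (monomials l i) = 'C(size l, i).
Proof. by rewrite size_map size_filter count_size_sublists. Qed.

Lemma monomials0 l : monomials l 0 = [:: 1].
Proof.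
elim: l => [|b l IHl] /=; first by rewrite /monomials /= /wedge big_nil.
rewrite /monomials /= filter_cat map_cat -/(monomials l 0) IHl filter_map.
by rewrite (_ : filter _ _ = [::]) //; apply: filter_pred0.
Qed.

Lemma monomials_cons b l i :
  monomials (b :: l) i.+1 =
  monomials l i.+1 ++ [seq iota b * x | x <- monomials l i].
Proof.
rewrite /monomials /= filter_cat map_cat filter_map -!map_comp; congr (_ ++ _).
rewrite (@eq_filter _ _ (fun m => size m == i)); last first.
  by move=> m /=; rewrite eqSS.
by apply: eq_map => m /=; rewrite /wedge big_cons.
Qed.

Lemma span_monomials_consl b l i :
  (<<monomials l i>> <= <<monomials (b :: l) i>>)%VS.
Proof.
case: i => [|i]; first by rewrite !monomials0.
by rewrite monomials_cons span_cat addvSl.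
Qed.

(** Multiplying by a vector of [l] stays within the span of the monomials: move
    the new factor past the larger ones, at the cost of a sign, until it reaches
    its place or meets a copy of itself and the product vanishes. *)
Lemma mul_span_monomials l v i x :
  v \in l -> x \in <<monomials l i>>%VS -> iota v * x \in <<monomials l i.+1>>%VS.
Proof.
move=> vl lx; pose f : 'End(exterior V) := amull (iota v).
have fE y : f y = iota v * y by rewrite lfunE.
rewrite -fE; move: x lx; apply: mem_span_map => x; rewrite {f}fE.
elim: l i v vl x => [//|b l IHl] i v; rewrite inE => /orP[/eqP->|vl] x.
  case: i => [|i]; rewrite monomials_cons.
    rewrite monomials0 inE => /eqP->; rewrite monomials0 span_cat.
    by rewrite -[iota b * 1]add0r memv_add ?mem0v ?memv_span ?mem_head.
  rewrite monomials_cons mem_cat => /orP[xl|/mapP[y _ ->]].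
    by rewrite memv_span // mem_cat map_f ?orbT.
  by rewrite mulrA ext_inj_sqr mul0r mem0v.
have step j y : y \in monomials l j ->
    iota v * y \in <<monomials (b :: l) j.+1>>%VS.
  by move=> ly; apply: (subvP (span_monomials_consl _ _ _)); apply: IHl.
case: i => [|i]; first by rewrite monomials0 -(monomials0 l); apply: step.
rewrite monomials_cons mem_cat => /orP[/step//|/mapP[y ly ->]].
(* The monomial starts with [b]: exchange [v] and [b], then use induction. *)
rewrite mulrA ext_inj_anticomm mulNr -mulrA memvN.
pose g : 'End(exterior V) := amull (iota b).
have gE z : g z = iota b * z by rewrite lfunE.
rewrite -gE; move: (IHl _ _ vl _ ly); move: (iota v * y).
apply: mem_span_map => z lz; rewrite gE monomials_cons memv_span //.
by rewrite mem_cat map_f ?orbT.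
Qed.

(** [mul_span_monomials] makes the monomials stable under multiplication by the
    span of [l], so by induction they span the whole power. *)
Lemma ext_pow_span l i : ext_pow <<l>>%VS i = <<monomials l i>>%VS.
Proof.
apply/eqP; rewrite eqEsubv; apply/andP; split.
  elim: i => [|i IHi]; first by rewrite monomials0 span_seq1.
  rewrite /ext_pow expvSl -/(ext_pow _ i).
  apply/prodvP => _ x /memv_imgP[v lv ->] Wx.
  pose f : 'End(exterior V) := amulr x.
  have fE y : f y = y * x by rewrite lfunE.
  rewrite -fE; apply: (mem_span_map (X := [seq iota u | u <- l])).
    move=> _ /mapP[u lu ->]; rewrite fE; apply: mul_span_monomials => //.
    exact: subvP IHi _ Wx.
  by rewrite -limg_span memv_img.
apply/span_subvP => x /mapP[m]; rewrite mem_filter => /andP[/eqP<- ml ->] {x i}.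
have {ml}: {subset m <= l}.
  elim: l m ml => [|b l IHl] m /=; first by rewrite inE => /eqP->.
  rewrite mem_cat => /orP[/IHl ml|/mapP[m' /IHl ml ->]] v.
    by rewrite inE => /ml->; rewrite orbT.
  by rewrite !inE => /orP[->//|/ml->]; rewrite orbT.
elim: m => [|v m IHm] ml; first by rewrite /wedge big_nil memv_line.
rewrite /wedge big_cons /ext_pow expvSl memv_mul //.
  by rewrite memv_img // memv_span // ml ?mem_head.
by apply: IHm => u um; rewrite ml // inE um orbT.
Qed.

(** Peel off one index at a time: by [ext_basisM] the product of [e_i] and
    [e_(A - i)] is [e_A] up to sign, and [e_i] is the image of a vector of the
    chosen basis of [V]. *)
Lemma ext_basis_in_ext_pow (A : {set 'I_(\dim {:V})}) :
  ext_basis K A \in ext_pow {:V} #|A|.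
Proof.
have [k] := ubnP #|A|; elim: k A => // k IHk A.
have [-> _|[i Ai] leAk] := set_0Vmem A.
  rewrite cards0 /ext_pow expv0; have -> : ext_basis K set0 = 1 :> exterior V.
    by apply/ffunP => B; rewrite !ffunE.
  exact: memv_line.
rewrite (cardsD1 i) Ai.
have inj_b : iota (vbasis {:V})`_i = ext_basis K [set i].
  rewrite lfunE /= /ext_inj_fun (bigD1 i) //= big1 => [|j ji].
    by rewrite coord_free ?(basis_free (vbasisP _)) // eqxx scale1r addr0.
  by rewrite coord_free ?(basis_free (vbasisP _)) // eq_sym (negPf ji) scale0r.
have dA : [disjoint [set i] & A :\ i] by rewrite disjoints1 !inE eqxx.
have := ext_basisM K [set i] (A :\ i); rewrite dA setD1K // => eA.
have -> : ext_basis K A = ext_sgn K [set i] (A :\ i) *: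
    (ext_basis K [set i] * ext_basis K (A :\ i)).
  by rewrite eA scalerA /ext_sgn -expr2 sqrr_sign scale1r.
rewrite memvZ // -inj_b /ext_pow expvSl memv_mul ?memv_img ?memvf //.
by apply: IHk; move: leAk; rewrite (cardsD1 i) Ai.
Qed.

Lemma dim_exterior : \dim {: exterior V} = (2 ^ \dim {:V})%N.
Proof.
rewrite dimvf /dim /= muln1.
by rewrite -cardsT -powersetT card_powerset cardsT card_ord.
Qed.

Lemma span_all_monomials l : <<l>>%VS = fullv ->
  <<[seq wedge m | m <- sublists l]>>%VS = fullv.
Proof.
move=> lV; apply/eqP; rewrite eqEsubv subvf /=; apply/subvP => x _.
have -> : x = \sum_A x A *: (ext_basis K A : exterior V).
  apply/ffunP => B; rewrite sum_ffunE (bigD1 B) //= big1 => [|A AB].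
    by rewrite !ffunE eqxx addr0 /GRing.scale /= mulr1.
  by rewrite !ffunE eq_sym (negPf AB) /GRing.scale /= mulr0.
apply: memv_suml => A _; apply: memvZ.
have lA : (ext_pow {:V} #|A| <= <<monomials l #|A|>>)%VS.
  by rewrite -ext_pow_span lV.
apply: subvP (subv_trans lA _) _ (ext_basis_in_ext_pow A).
apply: sub_span => y /mapP[m]; rewrite mem_filter => /andP[_ ml] ->.
exact: map_f.
Qed.

(** A spanning family is free when it has as many members as the dimension. *)
Lemma free_all_monomials l : basis_of fullv l ->
  free [seq wedge m | m <- sublists l].
Proof.
move=> bl; have lV := span_basis bl.
apply: (@basis_free _ _ fullv); rewrite basisEdim span_all_monomials // subvv /=.
rewrite size_map size_sublists dim_exterior leq_exp2l //.
by rewrite -lV (eqnP (basis_free bl)).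
Qed.

(** The monomials on a basis of [W] are among those on a basis of [V] that
    extends it, hence free by [free_all_monomials]. *)
Lemma dim_ext_pow W i : \dim (ext_pow W i) = 'C(\dim W, i).
Proof.
pose l := vbasis W; have lW : <<l>>%VS = W := span_basis (vbasisP W).
(* [l] must come last: [sublists (b :: l')] begins with [sublists l'], so the
   monomials on [l] are a prefix of those on the extended basis. *)
have bV : basis_of fullv (vbasis W^C ++ l).
  rewrite -(addv_complf W) addvC; apply: cat_basis; try exact: vbasisP.
  by rewrite directvE /= -dimv_disjoint_sum // capvC capv_compl.
have : free [seq wedge m | m <- sublists l].
  have := free_all_monomials bV; elim: (tval (vbasis _^C)) => //= b l' IH.
  by rewrite map_cat => /catl_free.
rewrite -(perm_free (perm_map _
  (permEl (perm_filterC (fun m => size m == i) _)))) map_cat.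
move=> /catl_free/eqnP; rewrite -/(monomials l i) -ext_pow_span lW size_monomials.
by rewrite size_tuple.
Qed.
End ExteriorDim.

(** * Orthogonal projections *)

Section Projection.
Variables (K : fieldType) (V : vectType K) (dot : {symmetric V}).
Implicit Types (u v x y : V) (W : {vspace V}).

Lemma orthov_addv U W : orthov dot (U + W) = (orthov dot U :&: orthov dot W)%VS.
Proof.
by apply/vspaceP => x; rewrite memv_cap memvE orthovD -!memvE.
Qed.

(** Each vector of a basis of [W] imposes one linear equation on [orthov W]. *)
Lemma leq_dim_orthov W : (\dim {:V} <= \dim (orthov dot W) + \dim W)%N.
Proof.
have -> : W = <<vbasis W>>%VS by rewrite (span_basis (vbasisP W)).
rewrite (eqnP (basis_free (vbasisP W))); elim: (tval (vbasis W)) => [|u l IHl] /=.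
  by rewrite span_nil orthov0 addn0.
rewrite span_cons orthov_addv capvC addnS -addSn.
apply: leq_trans IHl _; rewrite leq_add2r; apply: leq_trans (leqSpred _) _.
by rewrite ltnS leq_dim_orthov1.
Qed.

Lemma addv_orthov W : nondegenerate_on dot W -> (W + orthov dot W = fullv)%VS.
Proof.
move=> ndW; apply/eqP; rewrite -(dimv_leqif_eq (subvf _)) dimv_disjoint_sum //.
by rewrite eqn_leq addnC leq_dim_orthov -dimv_disjoint_sum 1?capvC // dimvS ?subvf.
Qed.

Lemma memv_orth_proj W x : orth_proj dot W x \in W.
Proof. exact: memv_pi. Qed.

Lemma sub_orth_proj W x : nondegenerate_on dot W ->
  x - orth_proj dot W x \in orthov dot W.
Proof.
move=> ndW; have xWW : x \in (W + orthov dot W)%VS by rewrite addv_orthov ?memvf.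
by rewrite -{1}(daddv_pi_add ndW xWW) addrC addKr memv_pi.
Qed.

(** Write [W'] for [W :&: orthov dot <[u]>], and [a] for the projection of [u]
    to [W]. On [W], pairing with [u] is pairing with [a],
    so [a] is orthogonal to [W'], as is the difference of the two projections of
    [x], and in [W] the orthogonal complement of [W'] is the line of [a]. *)
Lemma orth_proj_cap W u x : nondegenerate_on dot W ->
  nondegenerate_on dot (W :&: orthov dot <[u]>) ->
  exists k, orth_proj dot (W :&: orthov dot <[u]>) x =
            orth_proj dot W x + k *: orth_proj dot W u.
Proof.
set W' := (W :&: _)%VS => ndW ndW'; set a := orth_proj dot W u.
have aW : a \in W := memv_orth_proj _ _.
have ua y : y \in W -> dot y u = dot y a.
  move=> yW; apply/eqP; rewrite -subr_eq0 -linearBr /= herm_eq0C.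
  by rewrite (mem_orthovP (sub_orth_proj u ndW)).
have memW' y : y \in W -> dot y a = 0 -> y \in W'.
  by move=> yW ya; rewrite memv_cap yW mem_orthov1 ua ?ya /=.
have aW' : a \in orthov dot W'.
  apply/mem_orthovP => y; rewrite memv_cap mem_orthov1 => /andP[yW yu].
  by apply/eqP; rewrite herm_eq0C -ua.
have eq0 y : y \in W' -> y \in orthov dot W' -> y = 0.
  by move=> yW yW'; apply/eqP; rewrite -memv0 -ndW' memv_cap yW.
pose d := orth_proj dot W' x - orth_proj dot W x.
have dW : d \in W.
  rewrite memvB ?memv_orth_proj //.
  by move: (memv_orth_proj W' x : orth_proj dot W' x \in W'); apply/subvP/capvSl.
have dW' : d \in orthov dot W'.
  have -> : d = (x - orth_proj dot W x) - (x - orth_proj dot W' x).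
    by rewrite opprB [RHS]addrC addrA subrK.
  rewrite memvB ?sub_orth_proj //; apply/mem_orthovP => y yW'.
  by apply: (mem_orthovP (sub_orth_proj x ndW)); move: yW'; apply/subvP/capvSl.
suff [k dk] : exists k, d = k *: a.
  by exists k; rewrite -dk /d addrC subrK.
(* If [a] is isotropic then it lies in [W'] and is orthogonal to it, so [a] is
   zero by nondegeneracy, and [W'] is all of [W]. *)
have [aa|aa] := eqVneq (dot a a) 0.
  have a0 : a = 0 by apply: eq0 => //; apply: memW'.
  exists 0; rewrite scale0r; apply: eq0 => //; apply: memW' => //.
  by rewrite a0 linear0r.
(* Gram-Schmidt: [d] minus its component along [a] is in [W']. *)
exists (dot d a / dot a a); apply/eqP; rewrite -subr_eq0; apply/eqP; apply: eq0.
  apply: memW'; first by rewrite memvB // memvZ.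
  by rewrite linearBl linearZl_LR /= divfK ?subrr.
by rewrite memvB // memvZ.
Qed.
End Projection.

(** * The complex and its homology *)

Lemma sum_antisym (Z : zmodType) n (P : pred 'I_n) (F : 'I_n -> 'I_n -> Z) :
  (forall i, F i i = 0) -> (forall i j, F i j = - F j i) ->
  \sum_(i | P i) \sum_(j | P j) F i j = 0.
Proof.
move=> Fii Fij.
have splitF i : P i -> \sum_(j | P j) F i j =
    \sum_(j | P j && (i < j)%N) F i j + \sum_(j | P j && (j < i)%N) F i j.
  move=> Pi; rewrite (bigD1 i) //= Fii add0r (bigID (fun j : 'I_n => i < j)%N) /=.
  congr (_ + _); apply: eq_bigl => j; rewrite -val_eqE /=; case: ltngtP => //;
  by rewrite ?andbT ?andbF.
rewrite (eq_bigr _ splitF) big_split /=.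
rewrite [X in _ + X](exchange_big_dep P) /=; last by move=> ? ? _ /andP[].
rewrite -big_split big1 //= => i Pi.
rewrite [X in _ + X](eq_bigl (fun j => P j && (i < j)%N)); last first.
  by move=> j; rewrite Pi.
by rewrite -big_split big1 //= => j _; rewrite (Fij j) subrr.
Qed.

Section Complex.
Variables (K : fieldType) (V : vectType K) (dot : {symmetric V}).
Variables (n : nat) (nu : 'I_n -> V).
Implicit Types (S T U : {set 'I_n}) (c : chain V n).
Local Notation iota := (ext_inj V).
Local Notation flat := (flat dot nu).
Local Notation diff := (diff dot nu).
Local Notation chain_deg := (chain_deg dot nu).

Lemma chain_injE S (w : exterior V) T : chain_inj V S w T = if T == S then w else 0.
Proof. by rewrite lfunE /= ffunE. Qed.

Lemma chain_projE S c : chain_proj V S c = c S.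
Proof. by rewrite lfunE. Qed.

(** The component of the differential at its target: only the sets [s |: U] map
    to [U]. *)
Lemma diffE c U :
  diff c U = \sum_(s | s \notin U)
               iota (orth_proj dot (flat U) (nu s)) * c (s |: U).
Proof.
rewrite sum_lfunE sum_ffunE.
transitivity (\sum_(S : {set 'I_n}) \sum_(s in S) if U == S :\ s then
    iota (orth_proj dot (flat U) (nu s)) * c (s |: U) else 0).
  apply: eq_bigr => S _; rewrite sum_lfunE sum_ffunE; apply: eq_bigr => s sS.
  rewrite !comp_lfunE chain_injE chain_projE; case: eqP => // ->.
  by rewrite lfunE /= setD1K.
rewrite (exchange_big_dep predT) //= [RHS]big_mkcond /=; apply: eq_bigr => s _.
case: ifP => sU; last first.
  rewrite big1 // => S sS; case: eqP => // eU.
  by move: sU; rewrite eU !inE eqxx.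
rewrite (bigD1 (s |: U)) /=; last by rewrite setU11.
rewrite setU1K // eqxx big1 ?addr0 // => S /andP[sS neS].
by case: eqP => // eU; move: neS; rewrite eU setD1K ?eqxx.
Qed.

Lemma flatU1 t U : flat (t |: U) = (flat U :&: orthov dot <[nu t]>)%VS.
Proof.
apply/eqP; rewrite eqEsubv subv_cap; apply/andP; split; first (apply/andP; split).
- by apply/subv_bigcapP => s sU; apply: bigcapv_inf (subvv _); rewrite !inE sU orbT.
- by apply: bigcapv_inf (subvv _); rewrite setU11.
apply/subv_bigcapP => s; rewrite !inE => /orP[/eqP->|sU]; first exact: capvSr.
by apply: subv_trans (capvSl _ _) _; apply: bigcapv_inf (subvv _).
Qed.

(** By [orth_proj_cap] the projections to the intermediate flats can be replaced
    by projections to [flat U]; the summand is then antisymmetric in the two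
    removed indices. *)
Lemma diff_diff :
  (forall S s, s \in S -> nondegenerate_on dot (flat (S :\ s))) ->
  forall c, diff (diff c) = 0.
Proof.
move=> ndS c; apply/ffunP => U; rewrite diffE ffunE.
pose a s := iota (orth_proj dot (flat U) (nu s)).
have ndU T s : s \notin T -> nondegenerate_on dot (flat T).
  by move=> sT; rewrite -(setU1K sT); apply: ndS; rewrite setU11.
rewrite -[RHS](@sum_antisym _ n [pred t | t \notin U]
   (fun t s => a t * a s * c (s |: (t |: U)))).
- (* The inner sum avoids [t] as well; the extra term [s = t] is zero. *)
  apply: eq_bigr => t tU; rewrite diffE mulr_sumr.
  rewrite [RHS](bigD1 t) //= -/(a t) ext_inj_sqr mul0r add0r.
  apply: eq_big => [s|s]; first by rewrite !inE negb_or andbC.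
  rewrite mulrA => sU; congr (_ * _).
  have ndtU := ndU _ _ sU; rewrite flatU1 in ndtU.
  have [k] := orth_proj_cap (nu s) (ndU _ _ tU) ndtU.
  rewrite -flatU1 => ->; rewrite linearD linearZ /= mulrDr -/(a t) -/(a s).
  by rewrite -scalerAr ext_inj_sqr scaler0 addr0.
- by move=> t; rewrite ext_inj_sqr mul0r.
- by move=> s t; rewrite -mulNr -ext_inj_anticomm setUCA.
Qed.

Lemma chain_degP a i c :
  reflect (forall S,
             c S \in if (#|S| + i == a)%N then ext_pow (flat S) i else 0%VS)
          (c \in chain_deg a i).
Proof.
apply: (iffP idP) => [|cS].
  case/memv_sumP => w wS -> S; rewrite sum_ffunE; apply: memv_suml => T Ta.
  have /memv_imgP[x xT ->] := wS T Ta; rewrite chain_injE.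
  by case: eqP => [->|_]; [rewrite Ta | exact: mem0v].
have -> : c = \sum_(S : {set 'I_n} | (#|S| + i == a)%N) chain_inj V S (c S).
  apply/ffunP => T; rewrite sum_ffunE; have := cS T.
  case: ifP => Ta cT.
    rewrite (bigD1 T) //= big1 ?addr0 ?chain_injE ?eqxx // => S /andP[_ ST].
    by rewrite chain_injE eq_sym (negPf ST).
  rewrite big1 => [|S Sa]; first by apply/eqP; rewrite -memv0.
  by rewrite chain_injE; case: (T =P S) Sa => // <-; rewrite Ta.
by apply: memv_sumr => S Sa; rewrite memv_img //; have := cS S; rewrite Sa.
Qed.

Lemma limg_diff a i : (diff @: chain_deg a i <= chain_deg a i.+1)%VS.
Proof.
apply/subvP => _ /memv_imgP[c /chain_degP cS ->]; apply/chain_degP => S.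
rewrite diffE; apply: memv_suml => s sS; have := cS (s |: S).
rewrite cardsU1 sS -addnA add1n -addnS; case: ifP => _ cSs.
  rewrite /ext_pow expvSl memv_mul ?memv_img ?memv_orth_proj //.
  apply: subvP cSs; apply: expvS; apply: limgS; rewrite flatU1; exact: capvSl.
by move: cSs; rewrite !memv0 => /eqP->; rewrite mulr0.
Qed.

Lemma dim_chain_deg a i :
  \dim (chain_deg a i) =
  (\sum_(S : {set 'I_n} | #|S| + i == a) 'C(\dim (flat S), i))%N.
Proof.
rewrite (directvP _) /=; last first.
  apply/directv_sum_independent => w wS w0 S Sa.
  have /memv_imgP[x _ ex] := wS S Sa; move/ffunP/(_ S): w0.
  rewrite sum_ffunE ffunE (bigD1 S) //= big1 ?addr0 => [|T /andP[Ta TS]].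
    by rewrite ex chain_injE eqxx => ->; rewrite linear0.
  by have /memv_imgP[y _ ->] := wS T Ta; rewrite chain_injE eq_sym (negPf TS).
apply: eq_bigr => S _; rewrite limg_dim_eq ?dim_ext_pow //.
apply/eqP; rewrite -subv0; apply/subvP => w; rewrite memv_cap memv_ker memv0.
by case/andP => _ /eqP/ffunP/(_ S); rewrite chain_injE eqxx ffunE => ->.
Qed.

(** Rank-nullity for the differential leaving [chain_deg a i], the boundaries
    being cycles by [diff_diff]. *)
Lemma dim_homology a i :
  (forall S s, s \in S -> nondegenerate_on dot (flat (S :\ s))) ->
  (\dim (homology dot nu a i) + \dim (boundaries dot nu a i)
   + \dim (boundaries dot nu a i.+1) = \dim (chain_deg a i))%N.
Proof.
move=> ndS; rewrite -[RHS](limg_ker_dim diff) -/(cycles _ _ _ _); congr addn.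
rewrite -[RHS](dimv_cap_compl _ (boundaries dot nu a i)) addnC; congr addn.
congr (\dim _); apply/esym/capv_idPr; case: i => [|i] /=; first exact: sub0v.
rewrite subv_cap limg_diff; apply/subvP => _ /memv_imgP[c _ ->].
by rewrite memv_ker diff_diff.
Qed.

Lemma boundaries_top a : boundaries dot nu a (\dim {:V}).+1 = 0%VS.
Proof.
apply/eqP; rewrite -subv0; apply: subv_trans (limg_diff _ _) _.
rewrite subv0 -dimv_eq0 dim_chain_deg big1 // => S _.
by rewrite bin_small // ltnS dimvS ?subvf.
Qed.

(** The rank of each differential enters two consecutive homology dimensions,
    with opposite signs. The partial sums differ by a single rank, which is zero
    in the top degree. *)
Lemma euler_poincare a :
  (forall S s, s \in S -> nondegenerate_on dot (flat (S :\ s))) ->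
  \sum_(i < (\dim {:V}).+1) (-1) ^+ i * (\dim (homology dot nu a i))%:Z =
  \sum_(i < (\dim {:V}).+1) (-1) ^+ i * (\dim (chain_deg a i))%:Z.
Proof.
move=> ndS.
pose b i := (\dim (boundaries dot nu a i))%:Z.
suff tele m : \sum_(i < m) (-1) ^+ i * (\dim (chain_deg a i))%:Z =
    \sum_(i < m) (-1) ^+ i * (\dim (homology dot nu a i))%:Z - (-1) ^+ m * b m.
  by rewrite tele /b boundaries_top dimv0 mulr0 subr0.
elim: m => [|m IHm]; first by rewrite !big_ord0 /b dimv0 mulr0 subr0.
rewrite !big_ord_recr /= IHm -(dim_homology _ _ ndS) !PoszD -/(b m) -/(b m.+1).
rewrite exprS; ring.
Qed.
End Complex.

(** * The generating function *)

(** The summation range may exceed [m], where the binomials vanish, so that the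
    same range serves all flats. *)
Lemma exp_subr_sum (R : comNzRingType) (x : R) m d : (m <= d)%N ->
  (1 - x) ^+ m = \sum_(i < d.+1) ((-1) ^+ i *+ 'C(m, i)) * x ^+ i.
Proof.
move=> le_md; rewrite exprBn.
under eq_bigr do rewrite expr1n mulr1 -mulrnAl.
rewrite (big_ord_widen d.+1 (fun i => (-1) ^+ i *+ 'C(m, i) * x ^+ i)) //.
rewrite big_mkcond; apply: eq_bigr => i _; case: ifP => // /negbT.
by rewrite -leqNgt => /bin_small ->; rewrite mulr0n mul0r.
Qed.

Theorem lemma2p4 (K : fieldType) (V : vectType K) (dot : {symmetric V})
    (n : nat) (nu : 'I_n -> V) :
  [pchar K] =i pred0 ->
  nondegenerate dot ->
  (forall (S : {set 'I_n}) (s : 'I_n), s \in S ->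
     nondegenerate_on dot (flat dot nu (S :\ s))) ->
  graded_euler_char dot nu = chi_bar dot nu.
Proof.
move=> _ _ ndS; rewrite /graded_euler_char /chi_bar; set d := \dim {:V}.
pose D (S : {set 'I_n}) := \dim (flat dot nu S).
pose t S i : {poly int} := ((-1) ^+ i *+ 'C(D S, i)) *: 'X^(#|S| + i).
transitivity (\sum_(a < (n + d).+1) \sum_(i < d.+1)
    \sum_(S : {set 'I_n} | (#|S| + i == a)%N) t S i).
  apply: eq_bigr => a _; rewrite -scaler_suml euler_poincare // scaler_suml.
  apply: eq_bigr => i _; rewrite dim_chain_deg /t.
  transitivity ((\sum_(S : {set 'I_n} | (#|S| + i == a)%N)
      (-1) ^+ i *+ 'C(D S, i) : int) *: 'X^a : {poly int}).
    by rewrite sumrMnr -mulr_natr natz.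
  by rewrite scaler_suml; apply: eq_bigr => S /eqP->.
transitivity (\sum_(i < d.+1) \sum_(S : {set 'I_n}) t S i).
  rewrite exchange_big; apply: eq_bigr => i _.
  rewrite (exchange_big_dep predT) //=; apply: eq_bigr => S _.
  (* The range of [a] contains every total degree that occurs. *)
  have lt_a : (#|S| + i < (n + d).+1)%N.
    rewrite ltnS leq_add //; last by rewrite -ltnS.
    by rewrite -[leqRHS](card_ord n) max_card.
  rewrite (bigD1 (Ordinal lt_a)) //= big1 ?addr0 // => a /andP[/eqP ea].
  by rewrite -val_eqE /= ea eqxx.
rewrite exchange_big; apply: eq_bigr => S _.
rewrite (@exp_subr_sum _ _ _ d) ?dimvS ?subvf // mulr_sumr.
apply: eq_bigr => i _.
rewrite /t exprD -mul_polyC polyCMn rmorphXn rmorphN1; ring.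
Qed.
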